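(* Let $F_0:A_0\to[0,\infty)$ be a conic Finsler metric on a manifold $M$, with fundamental tensor $g^0$ and angular metric $h^0$, let $\beta$ be a one-form on $M$, and let $q>0$. Consider $F=F_0^{q+1}/|\beta|^q$ on $A=\{v\in A_0:\beta(v)\ne0\}$, assuming $\pi(A)=M$. Then $F$ is a conic Finsler metric defined on $A$, with fundamental tensor $g$ determined by $$\Big|\frac{\beta(v)}{F_0(v)}\Big|^{2q}g_v(w,w)=(q+1)h^0_v(w,w)+q(q+1)\Big(\frac{g^0_v(v,w)}{F_0(v)}-\frac{F_0(v)}{\beta(v)}\beta(w)\Big)^2+\Big((q+1)\frac{g^0_v(v,w)}{F_0(v)}-q\frac{F_0(v)}{\beta(v)}\beta(w)\Big)^2,$$ where $v\in A$ and $w\in T_{\pi(v)}M$. In particular, any Kropina metric $F=\alpha^2/|\beta|$, where $\alpha$ is the square root of a Riemannian metric, is strongly convex (i.e. its fundamental tensor is positive definite) in its natural domain of definition $\{v\in TM:\beta(v)\neq0\}$.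
   Context: Let $\pi:TM\to M$ be the natural projection. A conic Finsler metric on $M$ with domain $A$ is a continuous function $F:A\to[0,\infty)$, where $A\subset TM$ is open with $\pi(A)=M$ and conic ($v\in A$, $\lambda>0$ imply $\lambda v\in A$), which is smooth on $A$ except at most at the zero vectors, with $F(v)=0$ iff $v$ is a zero vector, $F(\lambda v)=\lambda F(v)$ for $\lambda>0$, $v\in A$, and whose fundamental tensor $g_v(u,w)=\frac12\frac{\partial^2}{\partial t\partial s}F(v+tu+sw)^2|_{t=s=0}$ ($u,w\in T_{\pi(v)}M$) is positive definite for all nonzero $v\in A$. The angular metric of $F_0$ is $h^0_v(w,w)=g^0_v(w,w)-\frac1{F_0(v)^2}g^0_v(v,w)^2$. *)

(* Defs.v *)
From HB Require Import structures.
From mathcomp Require Import all_boot all_order all_algebra.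
From mathcomp Require Import all_classical all_reals all_analysis.

Set Implicit Arguments.
Unset Strict Implicit.
Unset Printing Implicit Defensive.

Import Order.TTheory GRing.Theory Num.Theory.
Import numFieldNormedType.Exports.

Local Open Scope classical_set_scope.
Local Open Scope ring_scope.

(* C^k and C^infinity maps on an open subset U of a finite-dimensional space:
   f is C^(k+1) when it is differentiable on U and all the maps x |-> df_x(v)
   are C^k. Values of f outside U are irrelevant. *)
Fixpoint Ck_on (R : realType) (V W : normedModType R) (k : nat)
    (U : set V) (f : V -> W) : Prop :=
  match k with
  | 0 => forall x, U x -> {for x, continuous f}
  | k'.+1 => (forall x, U x -> differentiable f x) /\
             (forall v : V, Ck_on k' U (fun x => 'd f x v))
  end.

Definition smooth_on (R : realType) (V W : normedModType R)
    (U : set V) (f : V -> W) : Prop := forall k, Ck_on k U f.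

(* Smooth n-manifolds, given by an atlas. The chart i is the homeomorphism
   [chart i] from [chart_dom i] onto an open subset of R^n, with inverse
   [param i]; both are total functions whose values outside of these open sets
   are irrelevant. *)
Record manifold (R : realType) (n : nat) := Manifold {
  points :> topologicalType;
  points_hausdorff : hausdorff_space points;
  points_second_countable : @second_countable points;
  chart_idx : Type;
  chart_dom : chart_idx -> set points;
  chart : chart_idx -> points -> 'rV[R]_n;
  param : chart_idx -> 'rV[R]_n -> points;
  chart_dom_open : forall i, open (chart_dom i);
  chart_cover : forall p, exists i, chart_dom i p;
  chart_img_open : forall i, open (chart i @` chart_dom i);
  chartK : forall i p, chart_dom i p -> param i (chart i p) = p;
  chart_continuous : forall i, {within chart_dom i, continuous (chart i)};
  param_continuous :
    forall i, {within chart i @` chart_dom i, continuous (param i)};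
  chart_compatible : forall i j,
    smooth_on (chart i @` (chart_dom i `&` chart_dom j))
              (chart j \o param i)
}.

Section TangentBundle.
Context {R : realType} {n : nat}.
Variable M : manifold R n.

Definition chart_img (i : chart_idx M) : set 'rV[R]_n :=
  chart i @` chart_dom i.

Definition chart_at (p : M) : chart_idx M := projT1 (cid (chart_cover p)).

(* T_pM is R^n, a tangent vector being given by its components in the chosen
   chart [chart_at p]; its components in any other chart around p are obtained
   by applying the differential of the change of coordinates, see
   [vec_of_coords]. *)
Definition tangent (p : M) : normedModType R := 'rV[R]_n.

Record TM := TVec { base_pt : M; vec : tangent base_pt }.

HB.instance Definition _ := gen_eqMixin TM.
HB.instance Definition _ := gen_choiceMixin TM.

(* The tangent vector at [param i x] with components y in the chart i. *)
Definition vec_of_coords (i : chart_idx M) (x y : 'rV[R]_n) :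
    tangent (param i x) :=
  'd (chart (chart_at (param i x)) \o param i) x y.

(* The inverse of the chart of TM induced by the chart i, defined on
   [chart_img i `*` setT]. *)
Definition tparam (i : chart_idx M) (z : 'rV[R]_n * 'rV[R]_n) : TM :=
  TVec (vec_of_coords i z.1 z.2).

Definition tcoords (i : chart_idx M) (A : set TM) :
    set ('rV[R]_n * 'rV[R]_n) :=
  (chart_img i `*` setT) `&` (tparam i @^-1` A).

(* The topology of TM: a set is open iff it is so in all the induced charts. *)
Definition TM_open (A : set TM) : Prop := forall i, open (tcoords i A).

Let TM_openT : TM_open setT.
Proof.
move=> i; rewrite /tcoords preimage_setT setIT.
have -> : chart_img i `*` setT =
    (fst : 'rV[R]_n * 'rV[R]_n -> _) @^-1` chart_img i.
  by apply/seteqP; split=> [z []|z] //=.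
by apply: open_comp; [move=> z _; exact: cvg_fst|exact: chart_img_open].
Qed.

Let TM_openI : setI_closed TM_open.
Proof.
move=> A B oA oB i; rewrite /tcoords preimage_setI setIIr.
exact: openI (oA i) (oB i).
Qed.

Let TM_open_bigcup (I : Type) (A : I -> set TM) :
  (forall k, TM_open (A k)) -> TM_open (\bigcup_k A k).
Proof.
move=> oA i; rewrite /tcoords preimage_bigcup setI_bigcupr.
by apply: bigcup_open => k _; exact: oA.
Qed.

HB.instance Definition _ :=
  isOpenTopological.Build TM TM_openT TM_openI TM_open_bigcup.

Definition scaleTM (c : R) (v : TM) : TM := TVec (c *: vec v).

Definition zero_section : set TM := [set v | vec v = 0].

Definition smoothTM_on (A : set TM) (F : TM -> R) : Prop :=
  forall i, smooth_on (tcoords i A) (F \o tparam i).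

(* The j-th coordinate vector field of the chart i, at [param i x]. *)
Definition coord_field (i : chart_idx M) (j : 'I_n) (x : 'rV[R]_n) :
    tangent (param i x) :=
  vec_of_coords i x (delta_mx 0 j).

Record one_form := OneForm {
  form_at : forall p : M, {scalar tangent p};
  form_smooth : forall i j,
    smooth_on (chart_img i)
      (fun x : 'rV[R]_n => form_at (param i x) (coord_field i j x) : R)
}.

Definition form_eval (b : one_form) (v : TM) : R :=
  form_at b (base_pt v) (vec v).

Record riemannian_metric := RiemannianMetric {
  metric_at : forall p : M, tangent p -> tangent p -> R;
  metric_sym : forall p (u w : tangent p), metric_at u w = metric_at w u;
  metric_linear : forall p (c : R) (u u' w : tangent p),
    metric_at (c *: u + u') w = c * metric_at u w + metric_at u' w;
  metric_pos : forall p (w : tangent p), w != 0 -> 0 < metric_at w w;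
  metric_smooth : forall i j k,
    smooth_on (chart_img i) (fun x : 'rV[R]_n =>
      metric_at (coord_field i j x) (coord_field i k x))
}.

Definition metric_norm (a : riemannian_metric) (v : TM) : R :=
  Num.sqrt (metric_at a (vec v) (vec v)).

(* Below, a function F : A -> R on an open subset A of TM is represented by a
   total function, whose values outside A are irrelevant. *)

Definition fundamental_tensor (F : TM -> R) (v : TM)
    (u w : tangent (base_pt v)) : R :=
  2^-1 * derive1 (fun t : R =>
    derive1 (fun s : R => F (TVec (vec v + t *: u + s *: w)) ^+ 2) 0) 0.

Definition angular_metric (F : TM -> R) (v : TM)
    (w : tangent (base_pt v)) : R :=
  fundamental_tensor F w w
  - (F v ^+ 2)^-1 * fundamental_tensor F (vec v) w ^+ 2.

Definition strongly_convex (A : set TM) (F : TM -> R) : Prop :=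
  forall v, A v -> vec v != 0 ->
  forall w : tangent (base_pt v), w != 0 -> 0 < fundamental_tensor F w w.

Record conic_finsler (A : set TM) (F : TM -> R) : Prop := ConicFinsler {
  finsler_dom_open : open A;
  finsler_dom_surj : base_pt @` A = setT;
  finsler_dom_conic : forall v (c : R), A v -> 0 < c -> A (scaleTM c v);
  finsler_continuous : {within A, continuous F};
  finsler_smooth : smoothTM_on (A `\` zero_section) F;
  finsler_ge0 : forall v, A v -> 0 <= F v;
  finsler_eq0 : forall v, A v -> (F v = 0 <-> zero_section v);
  finsler_homog : forall v (c : R), A v -> 0 < c -> F (scaleTM c v) = c * F v;
  finsler_convex : strongly_convex A F
}.

End TangentBundle.

Arguments fundamental_tensor {R n M} F v u w.
Arguments angular_metric {R n M} F v w.
Arguments base_pt {R n M} t.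
Arguments vec {R n M} t.
Arguments zero_section {R n M} _.

(* Main.v *)
(* The fundamental tensor on the diagonal only depends on the restriction of the
   metric to an affine line: g_v(w,w) is half the second derivative at 0 of
   r |-> F(v + r w)^2. Writing p(r) = F_0(v + r w)^2, homogeneity of F_0 gives
   p'(0) = 2 g^0_v(v,w), and F^2 = p^(q+1) (beta^2)^(-q) along the line, so the
   formula is the second derivative of this product. Homogeneity also turns
   F_0(v + r (w - c v))^2 into (1 - r c)^2 p(r / (1 - r c)), whence
   g^0(w - c v, w - c v) = g^0(w,w) - 2 c g^0(v,w) + c^2 F_0(v)^2; for
   c = g^0(v,w) / F_0(v)^2 this is h^0(w,w), which is therefore positive unless
   w = c v, and in that case the last square of the formula is c^2 F_0(v)^2. *)
From HB Require Import structures.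
Require Import Defs.
From mathcomp Require Import all_boot all_order all_algebra.
From mathcomp Require Import all_classical all_reals all_analysis.
From mathcomp Require Import ring.

Set Implicit Arguments.
Unset Strict Implicit.
Unset Printing Implicit Defensive.

Import Order.TTheory GRing.Theory Num.Theory.
Import numFieldNormedType.Exports.

Local Open Scope classical_set_scope.
Local Open Scope ring_scope.

(** * Closure of [Ck_on] under sums, products, real powers and the projection [fst] *)

Section Ck.
Context {R : realType}.
Implicit Types V W : normedModType R.

(** Differentiability only depends on the germ: the first-order expansion of [f] at [x] is also one
    of [g], and uniqueness of the differential carries its continuity over. *)
Lemma near_eq_differentiable V W (f g : V -> W) (x : V) :
  (\near x, f x = g x) -> differentiable f x -> differentiable g x.
Proof.
move=> fg /diff_locallyP [dfc dfx]; apply/diff_locallyP.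
have dgx : g \o shift x = cst (g x) + 'd f x +o_ 0 id.
  apply/eqaddoP => e e0; have /eqaddoP/(_ e e0) := dfx.
  have fg0 : \forall h \near 0, f (h + x) = g (h + x).
    by move: fg; rewrite (near_shift 0 x)/= ; apply: filterS => h /=; rewrite subr0.
  apply: filter_app; near=> h => /=.
  rewrite !fctE /= (nbhs_singleton fg); congr (`|_ - _| <= _).
  by near: h.
have E := diff_unique dfc dgx; split; last by rewrite E.
by move=> y; rewrite E; exact: dfc.
Unshelve. all: by end_near. Qed.

Lemma near_eq_diff V W (f g : V -> W) (x v : V) :
  (\near x, f x = g x) -> differentiable f x -> 'd f x v = 'd g x v.
Proof.
move=> fg df; rewrite -!deriveE//; last exact: near_eq_differentiable df.
exact: near_eq_derive.
Qed.

Lemma Ck_on_sub V W k (U U' : set V) (f : V -> W) :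
  U' `<=` U -> Ck_on k U f -> Ck_on k U' f.
Proof.
elim: k f => [|k IH] f UU' /=; first by move=> cf x /UU'; exact: cf.
by case=> df cf; split=> [x /UU'|v]; [exact: df|exact: IH].
Qed.

(** On an open set pointwise equality is equality of germs, so it passes to differentials. The
    inductions below use it to trade ['d] for an explicit formula. *)
Lemma Ck_on_eq V W k (U : set V) (f g : V -> W) :
  open U -> (forall x, U x -> f x = g x) -> Ck_on k U f -> Ck_on k U g.
Proof.
move=> oU; elim: k f g => [|k IH] f g fg /=.
  move=> cf x Ux; have fgx : \forall y \near x, f y = g y.
    by apply: filterS fg _; exact: open_nbhs_nbhs.
  have gE : g @ x --> f x by apply: cvg_trans (cf x Ux); exact: near_eq_cvg.
  by rewrite (fg x Ux) in gE.
have fgn x : U x -> \near x, f x = g x.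
  by move=> Ux; apply: filterS fg _; exact: open_nbhs_nbhs.
case=> df cf; split=> [x Ux|v].
  by apply: near_eq_differentiable (df x Ux); exact: fgn.
apply: IH (cf v) => x Ux; apply: near_eq_diff (df x Ux); exact: fgn.
Qed.

Lemma Ck_onW V W k (U : set V) (f : V -> W) : Ck_on k.+1 U f -> Ck_on k U f.
Proof.
elim: k f => [|k IH] f [df cf].
  by move=> x /df; exact: differentiable_continuous.
by split=> // v; apply: IH; exact: cf.
Qed.

Lemma Ck_on_cst V W k (U : set V) (c : W) : Ck_on k U (fun=> c).
Proof.
elim: k c => [|k IH] c /=; first by move=> x _; exact: cvg_cst.
split=> [x _|v]; first exact: differentiable_cst.
by rewrite (_ : (fun _ => _) = fun=> 0)//; apply/funext => x; rewrite diff_cst.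
Qed.

Lemma Ck_on_linear V W k (U : set V) (f : {linear V -> W}) :
  continuous f -> Ck_on k U f.
Proof.
move=> cf; case: k => [x _|k]; first exact: cf.
split=> [x _|v]; first exact: linear_differentiable.
rewrite (_ : (fun _ => _) = fun=> f v); first exact: Ck_on_cst.
by apply/funext => x; rewrite diff_lin.
Qed.

Lemma Ck_onD V W k (U : set V) (f g : V -> W) : open U ->
  Ck_on k U f -> Ck_on k U g -> Ck_on k U (f \+ g).
Proof.
move=> oU; elim: k f g => [|k IH] f g /=.
  by move=> cf cg x Ux; apply: continuousD; [exact: cf|exact: cg].
move=> [df cf] [dg cg]; split=> [x Ux|v].
  by apply: differentiableD; [exact: df|exact: dg].
apply: Ck_on_eq (IH _ _ (cf v) (cg v)) => // x Ux /=.
exact: esym (congr1 (fun h : V -> W => h v) (diffD (df x Ux) (dg x Ux))).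
Qed.

Lemma Ck_on_sum V W k (U : set V) n (f : 'I_n -> V -> W) : open U ->
  (forall i, Ck_on k U (f i)) -> Ck_on k U (fun x => \sum_(i < n) f i x).
Proof.
move=> oU; elim: n f => [|n IH] f cf.
  rewrite (_ : (fun _ => _) = fun=> 0); first exact: Ck_on_cst.
  by apply/funext => x; rewrite big_ord0.
rewrite (_ : (fun _ => _) =
  (fun x => \sum_(i < n) f (widen_ord (leqnSn n) i) x) \+ f ord_max).
  by apply: Ck_onD => //; exact: IH.
by apply/funext => x; rewrite big_ord_recr.
Qed.

(** In the product rule [f dg + g df] the undifferentiated factors are used at the lower order,
    whence [Ck_onW]. *)
Lemma Ck_onM V k (U : set V) (f g : V -> R) : open U ->
  Ck_on k U f -> Ck_on k U g -> Ck_on k U (f \* g).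
Proof.
move=> oU; elim: k f g => [|k IH] f g.
  by move=> cf cg x Ux; apply: continuousM; [exact: cf|exact: cg].
move=> Cf Cg; have [df cf] := Cf; have [dg cg] := Cg; split=> [x Ux|v].
  by apply: differentiableM; [exact: df|exact: dg].
have := Ck_onD oU (IH _ _ (Ck_onW Cf) (cg v)) (IH _ _ (Ck_onW Cg) (cf v)).
apply: Ck_on_eq => // x Ux /=.
exact: esym (congr1 (fun h : V -> R => h v) (diffM (df x Ux) (dg x Ux))).
Qed.

Lemma diff_powR V (f : V -> R) (a : R) (x : V) : differentiable f x ->
  0 < f x -> is_diff x (fun y => f y `^ a) (fun v => a * f x `^ (a - 1) * 'd f x v).
Proof.
move=> df f0; have [dp pE] := @is_derive1_powR R a _ f0.
have dp' : differentiable (fun y : R => y `^ a) (f x) by apply/derivable1_diffP.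
split; first exact: (differentiable_comp df dp').
rewrite (diff_comp df dp'); apply/funext => v /=.
by rewrite (diff1E dp') derive1E pE; exact: mulrC.
Qed.

(** The exponent varies in the induction, since differentiating turns [a] into [a - 1]. *)
Lemma Ck_on_powR V k (U : set V) (f : V -> R) (a : R) : open U ->
  (forall x, U x -> 0 < f x) -> Ck_on k U f -> Ck_on k U (fun x => f x `^ a).
Proof.
move=> oU f0; elim: k f a f0 => [|k IH] f a f0.
  move=> cf x Ux; apply: (@continuous_comp _ _ _ f (fun y : R => y `^ a)).
    exact: cf.
  apply: differentiable_continuous; apply/derivable1_diffP.
  by apply: derivable_powR; rewrite in_itv/= f0.
move=> Cf; have [df cf] := Cf; split=> [x Ux|v].
  by have [] := diff_powR a (df x Ux) (f0 x Ux).
have := Ck_onM oU (Ck_onM oU (Ck_on_cst k U a) (IH _ (a - 1) f0 (Ck_onW Cf))) (cf v).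
apply: Ck_on_eq => // x Ux /=.
have [_ E] := diff_powR a (df x Ux) (f0 x Ux).
exact: esym (congr1 (fun h : V -> R => h v) E).
Qed.

Lemma open_setXT V V' (U : set V) : open U -> open (U `*` (setT : set V')).
Proof.
move=> oU; rewrite (_ : _ `*` _ = fst @^-1` U).
  by apply: open_comp => // z _; exact: cvg_fst.
by apply/seteqP; split=> [z []|z].
Qed.

(** The differential of [f \o fst] along [v] is that of [f] along [v.1], again a function of the
    first component, so the induction closes. This moves smooth coefficients from [M] to [TM]. *)
Lemma Ck_on_fst V V' W k (U : set V) (f : V -> W) : open U ->
  Ck_on k U f -> Ck_on k (U `*` setT) (fun z : V * V' => f z.1).
Proof.
move=> oU.
have cfst : continuous (fst : V * V' -> V) by move=> z; exact: cvg_fst.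
have dfst z : differentiable (fst : V * V' -> V) z by exact: linear_differentiable.
have oUT : open (U `*` (setT : set V')) by exact: open_setXT.
elim: k f => [|k IH] f.
  by move=> cf z [Uz _]; apply: continuous_comp; [exact: cfst|exact: cf].
move=> [df cf]; split=> [z [Uz _]|v].
  exact: (differentiable_comp (dfst z) (df _ Uz)).
apply: Ck_on_eq (IH _ (cf v.1)) => // z [Uz _] /=.
rewrite -[RHS]/('d (f \o fst) z v) (diff_comp (dfst z) (df _ Uz)) /=.
by rewrite (diff_lin z cfst).
Qed.

End Ck.

(** * Second derivatives at 0 of functions of one real variable *)

Section Line.
Context {R : realType}.

(** The derivative is factored as the power times its logarithmic derivative, ready for logarithmic
    differentiation of a product of powers. *)
Lemma is_derive_powR (p : R -> R) (a r dp : R) : 0 < p r ->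
  is_derive r 1 p dp ->
  is_derive r 1 (fun x => p x `^ a) (p r `^ a * (a * (dp / p r))).
Proof.
move=> p0 Dp; have Da := @is_derive1_powR R a _ p0.
apply: is_derive_eq (is_derive1_comp Da Dp) _.
have -> : p r `^ a = p r `^ (a - 1) * p r.
  rewrite -[X in _ * X](powRr1 (ltW p0)) -powRD ?subrK//.
  by rewrite (gt_eqF p0) implybT.
by field; rewrite gt_eqF.
Qed.

Lemma is_derive_affine (a b r : R) : is_derive r 1 (fun x => a + x * b) b.
Proof.
have D : is_derive r 1 (cst a + (id * cst b : R -> R)) b.
  by apply: is_derive_eq; rewrite scaler0 !add0r /cst; exact: mulr1.
exact: D.
Qed.

(** Logarithmic differentiation: with [L] the logarithmic derivative of [psi], [psi' = psi L] gives
    [psi'' = psi (L^2 + L')]. Using a power of the square of the affine factor avoids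
    differentiating an absolute value. *)
Lemma derive2_kropina (p dp : R -> R) (ddp b0 b1 q : R) :
  0 < p 0 -> b0 != 0 ->
  (\forall r \near (0 : R), is_derive (r : R) (1 : R) p (dp r)) ->
  is_derive (0 : R) 1 dp ddp ->
  derive1 (derive1 (fun r => p r `^ (q + 1) * ((b0 + r * b1) ^+ 2) `^ (- q))) 0
  = p 0 `^ (q + 1) * (b0 ^+ 2) `^ (- q) *
    (((q + 1) * (dp 0 / p 0) - q * (2 * (b1 / b0))) ^+ 2
     + (q + 1) * (ddp / p 0 - (dp 0 / p 0) ^+ 2)
     + q * (2 * (b1 / b0) ^+ 2)).
Proof.
move=> p0 b00 Dp Ddp.
set psi := fun r => _.
pose l r := b0 + r * b1.
pose L r := (q + 1) * (dp r / p r) - q * (2 * (b1 / l r)).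
have Dl (r : R) : is_derive r 1 l b1 by exact: is_derive_affine.
have cont (f : R -> R) (r d : R) : is_derive r 1 f d -> {for r, continuous f}.
  by case=> /derivable1_diffP /differentiable_continuous.
have pgt0 : \forall r \near (0 : R), 0 < p r.
  exact: (cont _ _ _ (nbhs_singleton Dp)) (lt_nbhsr p0).
have ln0 : \forall r \near (0 : R), l r != 0.
  have: {for 0, continuous l} by exact: cont (Dl 0).
  move=> /(_ [set x | x != 0]); apply.
  by rewrite /l mul0r addr0; apply: open_nbhs_nbhs; split=> //; exact: open_neq.
have Dpsi (r : R) : 0 < p r -> l r != 0 -> is_derive r 1 p (dp r) ->
    is_derive r 1 psi (psi r * L r).
  move=> pr lr Dpr.
  have D1 := is_derive_powR (q + 1) pr Dpr.
  have l2 : 0 < l r ^+ 2 by rewrite exprn_even_gt0.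
  have Dl2 : is_derive r 1 (fun x => l x ^+ 2) (2 * l r * b1).
    have D : is_derive r 1 (fun x => l x ^+ 2) _ := is_deriveX 2 (Dl r).
    by apply: (is_derive_eq D); rewrite /= expr1.
  have D2 := is_derive_powR (p := fun x => l x ^+ 2) (- q) l2 Dl2.
  have D : is_derive r 1 psi _ := is_deriveM D1 D2.
  apply: (is_derive_eq D).
  rewrite /psi /L -/(l r) /GRing.scale /=.
  by field; rewrite lr gt_eqF.
(* The identity holds where [p] is positive and differentiable and [l] does not vanish; a
   neighbourhood of 0 suffices to differentiate once more at 0. *)
have psiL : \forall r \near (0 : R), derive1 psi r = psi r * L r.
  near=> s; rewrite derive1E; apply: derive_val; apply: Dpsi; near: s.
  - exact: pgt0.
  - exact: ln0.
  - exact: Dp.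
have l0 : l 0 = b0 by rewrite /l mul0r addr0.
have lN0 : l 0 != 0 by rewrite l0.
have DL : is_derive (0 : R) 1 L ((q + 1) * (ddp / p 0 - (dp 0 / p 0) ^+ 2)
     + q * (2 * (b1 / b0) ^+ 2)).
  have pN0 : p 0 != 0 by rewrite gt_eqF.
  have D1 := is_deriveM Ddp (is_deriveV pN0 (nbhs_singleton Dp)).
  have D2 := is_deriveV lN0 (Dl 0).
  have D : is_derive (0 : R) 1 L _ :=
    is_deriveB (is_deriveZ (q + 1) D1) (is_deriveZ q (is_deriveZ 2 (is_deriveZ b1 D2))).
  apply: (is_derive_eq D).
  rewrite /GRing.scale /= l0.
  by field; rewrite b00 pN0.
have D := is_deriveM (Dpsi 0 p0 lN0 (nbhs_singleton Dp)) DL.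
rewrite derive1E (near_eq_derive _ psiL) [LHS](derive_val (is_derive := D)).
rewrite /psi /L /GRing.scale /= l0 mul0r addr0.
by field; rewrite b00 gt_eqF.
Unshelve. all: by end_near. Qed.

Lemma near_eq_derive2 (f g : R -> R) (x : R) : (\near x, f x = g x) ->
  derive1 (derive1 f) x = derive1 (derive1 g) x.
Proof.
move=> /near_join fg; rewrite [LHS]derive1E [RHS]derive1E.
apply: near_eq_derive; apply: filterS fg => y.
by rewrite !derive1E; exact: near_eq_derive.
Qed.

(** The function is the restriction to [v + r (w - c v)] of a 2-homogeneous function whose
    restriction to [v + r w] is [p], because [v + r (w - c v) = (1 - r c) (v + r / (1 - r c) w)]. *)
Lemma derive2_homothety (p dp : R -> R) (ddp c : R) :
  (\forall r \near (0 : R), is_derive (r : R) (1 : R) p (dp r)) ->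
  is_derive (0 : R) 1 dp ddp ->
  derive1 (derive1 (fun r => (1 - r * c) ^+ 2 * p (r / (1 - r * c)))) 0
  = ddp - 2 * c * dp 0 + 2 * c ^+ 2 * p 0.
Proof.
move=> Dp Ddp.
set m := fun r => _.
pose l r := 1 - r * c.
pose s r := r / l r.
have Dl (r : R) : is_derive r 1 l (- c).
  have D := is_derive_affine 1 (- c) r.
  by rewrite (_ : l = fun x => 1 + x * - c)//; apply/funext => x; rewrite mulrN.
have l0 : l 0 = 1 by rewrite /l mul0r subr0.
have s0 : s 0 = 0 by rewrite /s mul0r.
have Ds (r : R) : l r != 0 -> is_derive r 1 s (l r ^- 2).
  move=> lr; have D : is_derive r 1 s _ :=
    is_deriveM (is_derive_id r 1) (is_deriveV lr (Dl r)).
  apply: (is_derive_eq D); rewrite /GRing.scale /=.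
  (* [E] tells [field] that [l r + r c = 1], which reduces the numerator of the derivative to 1,
     while [l r] stays an atom known to be nonzero. *)
  have := erefl (l r); rewrite {2}/l => E.
  by field: E; rewrite lr.
have cont (f : R -> R) (r d : R) : is_derive r 1 f d -> {for r, continuous f}.
  by case=> /derivable1_diffP /differentiable_continuous.
have ln0 : \forall r \near (0 : R), l r != 0.
  have: {for 0, continuous l} by exact: cont (Dl 0).
  move=> /(_ [set x | x != 0]); apply; rewrite l0.
  by apply: open_nbhs_nbhs; split; [exact: open_neq|exact: oner_neq0].
have lN0 : l 0 != 0 by rewrite l0 oner_neq0.
have Dps : \forall r \near (0 : R), is_derive (s r) (1 : R) p (dp (s r)).
  have: {for 0, continuous s} by exact: cont (Ds 0 lN0).
  by move=> /(_ [set x | is_derive (x : R) (1 : R) p (dp x)]); rewrite /= s0; apply.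
(* In the derivative of [m], the factor [l r ^+ 2] cancels [s' = l r ^- 2], which leaves [dp (s r)]
   alone. *)
pose dm r := - 2 * c * (l r * p (s r)) + dp (s r).
have Dl2 (r : R) : is_derive r 1 (fun x => l x ^+ 2) (- 2 * c * l r).
  have D : is_derive r 1 (fun x => l x ^+ 2) _ := is_deriveX 2 (Dl r).
  by apply: (is_derive_eq D); rewrite /GRing.scale /= expr1; ring.
have mdm : \forall r \near (0 : R), derive1 m r = dm r.
  near=> r.
  have lr : l r != 0 by near: r.
  have Dpr : is_derive (s r) (1 : R) p (dp (s r)) by near: r.
  have D : is_derive r 1 m _ := is_deriveM (Dl2 r) (is_derive1_comp Dpr (Ds r lr)).
  rewrite derive1E [LHS](derive_val (is_derive := D)) /dm /GRing.scale /=.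
  by field.
have Dp0 : is_derive (s 0) 1 p (dp 0) by rewrite s0; exact: nbhs_singleton Dp.
have Ddp0 : is_derive (s 0) 1 dp ddp by rewrite s0.
have Ds0 := Ds 0 lN0.
have D : is_derive (0 : R) 1 dm _ :=
  is_deriveD (is_deriveZ (- 2 * c) (is_deriveM (Dl 0) (is_derive1_comp Dp0 Ds0)))
    (is_derive1_comp Ddp0 Ds0).
rewrite derive1E (near_eq_derive _ mdm) [LHS](derive_val (is_derive := D)).
rewrite /GRing.scale /= s0 l0.
by field.
Unshelve. all: by end_near. Qed.

End Line.

(** * Restriction of a function to an affine line of a normed space *)

Section DirectionalLine.
Context {R : realType} {V : normedModType R}.
Implicit Types (x d : V) (r : R).

Lemma continuous_line x d : continuous (fun r => x + r *: d).
Proof.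
by move=> r; apply: cvgD; [exact: cvg_cst|exact: scalel_continuous].
Qed.

Lemma is_derive_line (f : V -> R) x d r : differentiable f (x + r *: d) ->
  is_derive r 1 (fun s => f (x + s *: d)) ('d f (x + r *: d) d).
Proof.
move=> df.
have Dl : is_diff r (fun s => x + s *: d) ( *:%R ^~ d).
  have D : is_diff r (cst x + ( *:%R ^~ d)) (0 + ( *:%R ^~ d)).
    exact: is_diffD.
  by rewrite add0r in D.
have dl := ex_diff (is_diff_def := Dl).
have dc := differentiable_comp dl df.
split; first exact/derivable1_diffP.
by rewrite deriveE// (diff_comp dl df) /= (diff_val (is_diff_def := Dl)) /= scale1r.
Qed.

End DirectionalLine.

(** * Smooth functions on the tangent bundle, read in charts and along lines in a fibre *)

Section Manifold.
Context {R : realType} {n : nat} {M : manifold R n}.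
Implicit Types (A : set (TM M)) (F : TM M -> R) (b : one_form M) (p : M).

Lemma chart_at_dom p : chart_dom (chart_at p) p.
Proof. exact: projT2 (cid (chart_cover p)). Qed.

Lemma chart_img_chart_at p : chart_img (chart_at p) (chart (chart_at p) p).
Proof. by exists p => //; exact: chart_at_dom. Qed.

(** In the chart chosen at [p] the change of coordinates is the identity near the image of [p], and
    so is its differential: components are the vector itself. *)
Lemma tparam_chart_at p (y : 'rV[R]_n) :
  tparam (chart_at p) (chart (chart_at p) p, y) = TVec (y : tangent p).
Proof.
set i := chart_at p; set x := chart i p.
have xp : param i x = p by apply: chartK; exact: chart_at_dom.
have vE : vec_of_coords i x y = y.
  rewrite /vec_of_coords xp -/i.
  transitivity ('d (@id 'rV[R]_n) x y); last by rewrite diff_val.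
  symmetry; apply: near_eq_diff => //.
  have : \forall z \near x, chart_img i z.
    by apply: open_nbhs_nbhs; split; [exact: chart_img_open|exact: chart_img_chart_at].
  by apply: filterS => _ [r ir <-] /=; rewrite chartK.
rewrite /tparam [X in TVec X]vE.
(* The base points of the two vectors are only provably equal, and [vec] has a type depending on
   them, so [xp] is eliminated. *)
by move: xp => /= xp; case: _ / xp.
Qed.

Lemma vec_of_coords_sum (i : chart_idx M) (x y : 'rV[R]_n) :
  vec_of_coords i x y = \sum_(j < n) y 0 j *: coord_field i j x.
Proof.
rewrite {1}(row_sum_delta y) /vec_of_coords linear_sum.
by apply: eq_bigr => j _; rewrite linearZ.
Qed.

Lemma form_eval_tparam b (i : chart_idx M) z :
  form_eval b (tparam i z) =
  \sum_(j < n) z.2 0 j * form_at b (param i z.1) (coord_field i j z.1).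
Proof.
rewrite /form_eval /= vec_of_coords_sum linear_sum.
by apply: eq_bigr => j _; rewrite linearZ.
Qed.

Lemma form_evalD b p (u w : tangent p) (r : R) :
  form_eval b (TVec (u + r *: w)) = form_eval b (TVec u) + r * form_eval b (TVec w).
Proof. by rewrite /form_eval /= linearD linearZ. Qed.

Lemma form_evalZ b (v : TM M) (c : R) :
  form_eval b (scaleTM c v) = c * form_eval b v.
Proof. by rewrite /form_eval /= linearZ. Qed.

(** Keeps the domain of the new metric away from the zero section. *)
Lemma form_eval_neq0 b (v : TM M) : form_eval b v != 0 -> vec v != 0.
Proof. by apply: contraNneq => v0; rewrite /form_eval v0 linear0. Qed.

Lemma Ck_on_coord k (U : set ('rV[R]_n * 'rV[R]_n)) (j : 'I_n) :
  Ck_on k U (fun z => z.2 0 j : R).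
Proof.
pose f (z : 'rV[R]_n * 'rV[R]_n) : R := z.2 0 j.
have lf : linear f by move=> a u v; rewrite /f !mxE.
pose fM := GRing.isLinear.Build _ _ _ _ _ lf.
pose fL : {linear _ -> _} := HB.pack f fM.
apply: (@Ck_on_linear _ _ _ k U fL) => z.
apply: (@continuous_comp _ _ _ snd (fun y : 'rV[R]_n => y 0 j)).
  exact: cvg_snd.
exact: coord_continuous.
Qed.

Lemma tcoords_openT (i : chart_idx M) : open (chart_img i `*` (setT : set 'rV[R]_n)).
Proof. exact/open_setXT/chart_img_open. Qed.

(** In an induced chart the form is a sum of fibre coordinates times coefficients that are smooth in
    the base point. *)
Lemma smooth_form b : smoothTM_on setT (form_eval b).
Proof.
move=> i k; rewrite /tcoords preimage_setT setIT.
have oU := @tcoords_openT i.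
suff : Ck_on k (chart_img i `*` setT) (fun z : 'rV[R]_n * 'rV[R]_n =>
    \sum_(j < n) z.2 0 j * form_at b (param i z.1) (coord_field i j z.1) : R).
  by apply: Ck_on_eq => // z _; rewrite /= form_eval_tparam.
apply: Ck_on_sum => // j; apply: Ck_onM => //; first exact: Ck_on_coord.
have C := Ck_on_fst 'rV[R]_n (@chart_img_open _ _ M i) (form_smooth b i j k).
exact: C.
Qed.

Lemma open_TME A : open A = TM_open A.
Proof. by []. Qed.

(** Open sets of [TM] are tested in the induced charts, where the order 0 clause of smoothness makes
    the preimage of [B] within [A] open. *)
Lemma smoothTM_continuous A F : open A -> smoothTM_on A F -> {within A, continuous F}.
Proof.
move=> oA sF; rewrite continuous_open_subspace// => v /set_mem Av O.
rewrite nbhsE => -[B [oB Bv] BO].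
rewrite nbhs_simpl /= nbhsE; exists (A `&` F @^-1` B); last first.
  by move=> u [_ Bu]; exact: BO.
split=> //; rewrite open_TME => i; rewrite openE => z [zi [Az Bz]].
have zA : nbhs z (tcoords i A).
  by apply: open_nbhs_nbhs; split=> //; move: oA; rewrite open_TME; apply.
have zB : nbhs z ((F \o tparam i) @^-1` B).
  by apply: (sF i 0%N z) => //; exact: open_nbhs_nbhs.
rewrite /interior; near=> w.
have [wi Aw] : tcoords i A w by near: w.
by split=> //; split=> //; near: w.
Unshelve. all: by end_near. Qed.

Lemma smoothTM_sub A A' F : A' `<=` A -> smoothTM_on A F -> smoothTM_on A' F.
Proof.
by move=> AA sF i k; apply: Ck_on_sub (sF i k) => z [zi Az]; split=> //; exact: AA.
Qed.

Lemma open_form_neq0 b A : open A -> open [set v | A v /\ form_eval b v != 0].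
Proof.
move=> oA; apply: openI oA _.
have := smoothTM_continuous openT (smooth_form b).
rewrite continuous_open_subspace//; last exact: openT.
move=> cb; apply: (@open_comp _ _ (form_eval b) [set x | x != 0]); last exact: open_neq.
by move=> v _; apply: cb; rewrite inE.
Qed.

Lemma tparam_line p (u w : 'rV[R]_n) (r : R) :
  tparam (chart_at p) ((chart (chart_at p) p, u) + r *: (0, w)) =
  TVec (u + r *: w : tangent p).
Proof. by rewrite -tparam_chart_at; congr tparam; congr pair; rewrite /= scaler0 addr0. Qed.

Lemma tcoords_chart_at A (v : TM M) : A v ->
  tcoords (chart_at (base_pt v)) A (chart (chart_at (base_pt v)) (base_pt v), vec v).
Proof.
move=> Av; split; first by split=> //; exact: chart_img_chart_at.
by rewrite /preimage /= tparam_chart_at; case: v Av.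
Qed.

Lemma near_tcoords_line A (v : TM M) (w : tangent (base_pt v)) : open A -> A v ->
  let i := chart_at (base_pt v) in
  \forall r \near (0 : R), tcoords i A ((chart i (base_pt v), vec v) + r *: (0, w)).
Proof.
move=> oA Av i.
have /(_ 0) := @continuous_line R _ (chart i (base_pt v), vec v) (0, w).
rewrite /continuous_at scale0r addr0; apply.
apply: open_nbhs_nbhs; split; last exact: tcoords_chart_at.
by move: oA; rewrite open_TME; apply.
Qed.

Lemma near_line A (v : TM M) (w : tangent (base_pt v)) : open A -> A v ->
  \forall r \near (0 : R), A (TVec (vec v + r *: w)).
Proof.
move=> oA Av; apply: filterS (near_tcoords_line w oA Av) => r [_].
by rewrite /preimage /= tparam_line.
Qed.

(** In the chart chosen at the base point the line has constant direction [d = (0, w)], so order 2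
    smoothness lets [z |-> 'd G z d] be differentiated once more. This yields the [dp] and [ddp] of
    the one-variable lemmas. *)
Lemma smoothTM_line A F (v : TM M) (w : tangent (base_pt v)) :
  open A -> smoothTM_on A F -> A v ->
  exists (df : R -> R) (ddf : R),
   (\forall r \near (0 : R),
     is_derive (r : R) (1 : R) (fun r => F (TVec (vec v + r *: w))) (df r)) /\
   is_derive (0 : R) 1 df ddf.
Proof.
move=> oA sF Av; set i := chart_at (base_pt v).
set x := (chart i (base_pt v), vec v); set d : 'rV[R]_n * 'rV[R]_n := (0, w).
pose G := F \o tparam i.
have [dG /(_ d) [ddG _]] := sF i 2%N.
exists (fun r => 'd G (x + r *: d) d).
exists ('d (fun z => 'd G z d) x d); split.
  apply: filterS (near_tcoords_line w oA Av) => r /dG /is_derive_line D.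
  rewrite (_ : (fun _ => _) = fun s => G (x + s *: d))//.
  by apply/funext => s; rewrite /G /= tparam_line.
have := @is_derive_line R _ (fun z => 'd G z d) x d 0.
by rewrite scale0r addr0; apply; apply: ddG; exact: tcoords_chart_at.
Qed.

(** For equal arguments the two parameters enter only through their sum [t + s], so the inner
    derivative at [s = 0] is the derivative of the restriction to the line at [t]. *)
Lemma fundamental_tensor_diag F (v : TM M) (w : tangent (base_pt v)) :
  fundamental_tensor F v w w =
  2^-1 * derive1 (derive1 (fun r : R => F (TVec (vec v + r *: w)) ^+ 2)) 0.
Proof.
rewrite /fundamental_tensor.
have E : (fun t : R => derive1 (fun s : R =>
    F (TVec (vec v + t *: w + s *: w)) ^+ 2) 0) =
    derive1 (fun r : R => F (TVec (vec v + r *: w)) ^+ 2).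
  apply/funext => t; rewrite /derive1.
  (* The difference quotients agree for every [h], hence so do their limits. *)
  suff -> : (fun h : R => h^-1 *: (F (TVec (vec v + t *: w + (h + 0) *: w)) ^+ 2 -
      F (TVec (vec v + t *: w + 0 *: w)) ^+ 2)) =
    (fun h : R => h^-1 *: (F (TVec (vec v + (h + t) *: w)) ^+ 2 -
      F (TVec (vec v + t *: w)) ^+ 2)) by [].
  apply/funext => h.
  by rewrite addr0 scale0r addr0 -addrA -scalerDl [t + h]addrC.
by rewrite E.
Qed.

End Manifold.

(** * The norm of a Riemannian metric: homogeneity, smoothness of its square, convexity *)

Section Metric.
Context {R : realType} {n : nat} {M : manifold R n}.
Variable a : riemannian_metric M.
Implicit Types p : M.

Lemma metric_at0 p (w : tangent p) : metric_at a 0 w = 0.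
Proof.
by have := metric_linear a (-1) w w w; rewrite scaleN1r addNr mulN1r addNr.
Qed.

Lemma metric_atD p (u u' w : tangent p) :
  metric_at a (u + u') w = metric_at a u w + metric_at a u' w.
Proof. by have := metric_linear a 1 u u' w; rewrite scale1r mul1r. Qed.

Lemma metric_atZ p (c : R) (u w : tangent p) :
  metric_at a (c *: u) w = c * metric_at a u w.
Proof. by have := metric_linear a c u 0 w; rewrite metric_at0 !addr0. Qed.

Lemma metric_at_sum p (c : 'I_n -> R) (u : 'I_n -> tangent p) (w : tangent p) :
  metric_at a (\sum_j c j *: u j) w = \sum_j c j * metric_at a (u j) w.
Proof.
rewrite (big_morph (fun u => metric_at a u w) (fun u u' => metric_atD u u' w)
  (metric_at0 w)).
by apply: eq_bigr => j _; rewrite metric_atZ.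
Qed.

Lemma sqr_metric_norm (v : TM M) : metric_norm a v ^+ 2 = metric_at a (vec v) (vec v).
Proof.
rewrite /metric_norm sqr_sqrtr//.
have [->|v0] := eqVneq (vec v) 0; first by rewrite metric_at0.
exact/ltW/metric_pos.
Qed.

Lemma sqr_metric_norm_line p (u w : tangent p) (r : R) :
  metric_norm a (TVec (u + r *: w)) ^+ 2 =
  metric_at a u u + 2 * r * metric_at a u w + r ^+ 2 * metric_at a w w.
Proof.
rewrite sqr_metric_norm /= !metric_atD !metric_atZ.
rewrite (Defs.metric_sym a u (u + _)) (Defs.metric_sym a w (u + _)).
rewrite !metric_atD !metric_atZ.
rewrite (Defs.metric_sym a w u); ring.
Qed.

Lemma metric_norm_gt0 (v : TM M) : vec v != 0 -> 0 < metric_norm a v.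
Proof. by move=> v0; rewrite sqrtr_gt0; exact: metric_pos. Qed.

Lemma metric_normZ (v : TM M) (c : R) : 0 < c ->
  metric_norm a (scaleTM c v) = c * metric_norm a v.
Proof.
move=> c0; rewrite /metric_norm /= metric_atZ Defs.metric_sym metric_atZ mulrA -expr2.
by rewrite sqrtrM ?sqr_ge0// sqrtr_sqr gtr0_norm.
Qed.

(** The square is a quadratic polynomial in the fibre coordinates with smooth coefficients, so it is
    smooth on the zero section too. *)
Lemma smooth_sqr_metric_norm : smoothTM_on setT (fun v => metric_norm a v ^+ 2).
Proof.
move=> i k; rewrite /tcoords preimage_setT setIT.
have oU := @tcoords_openT _ _ M i.
suff : Ck_on k (chart_img i `*` setT) (fun z : 'rV[R]_n * 'rV[R]_n =>
    \sum_(j < n) z.2 0 j * (\sum_(l < n) z.2 0 l *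
      metric_at a (coord_field i j z.1) (coord_field i l z.1)) : R).
  apply: Ck_on_eq => // z _; rewrite /= sqr_metric_norm /= {1}vec_of_coords_sum.
  rewrite metric_at_sum; apply: eq_bigr => j _; congr (_ * _).
  rewrite Defs.metric_sym vec_of_coords_sum metric_at_sum.
  by apply: eq_bigr => l _; rewrite Defs.metric_sym.
apply: Ck_on_sum => // j; apply: Ck_onM => //; first exact: Ck_on_coord.
apply: Ck_on_sum => // l; apply: Ck_onM => //; first exact: Ck_on_coord.
have C := Ck_on_fst 'rV[R]_n (@chart_img_open _ _ M i) (metric_smooth a i j l k).
exact: C.
Qed.

(** Along a line the squared norm is a quadratic polynomial, and half its second derivative is the
    constant [metric_at a w w]. *)
Lemma strongly_convex_metric_norm (A : set (TM M)) : strongly_convex A (metric_norm a).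
Proof.
move=> v _ _ w w0; rewrite fundamental_tensor_diag.
set g := metric_at a; set p := fun r => _.
have pE : p = fun r => g _ (vec v) (vec v) + 2 * r * g _ (vec v) w + r ^+ 2 * g _ w w.
  by apply/funext => r; exact: sqr_metric_norm_line.
pose dp (r : R) := 2 * g _ (vec v) w + r * (2 * g _ w w).
have Dp (r : R) : is_derive r 1 p (dp r).
  have D : is_derive r 1 (fun r => g _ (vec v) (vec v) + r * (2 * g _ (vec v) w)
      + r ^+ 2 * g _ w w) _ :=
    is_deriveD (is_derive_affine (g _ (vec v) (vec v)) (2 * g _ (vec v) w) r)
      (is_deriveM (is_deriveX 2 (is_derive_id r 1)) (is_derive_cst (g _ w w) r 1)).
  rewrite pE (_ : (fun _ => _) = fun r => g _ (vec v) (vec v) + r * (2 * g _ (vec v) w)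
      + r ^+ 2 * g _ w w); last by apply/funext => s; ring.
  by apply: (is_derive_eq D); rewrite /GRing.scale /= /dp expr1; ring.
have -> : derive1 p = dp.
  by apply/funext => r; rewrite derive1E; exact: (derive_val (is_derive := Dp r)).
have D := is_derive_affine (2 * g _ (vec v) w) (2 * g _ w w) 0.
rewrite derive1E [X in _ * X](derive_val (is_derive := D)) mulrA mulVf// mul1r.
exact: metric_pos.
Qed.

End Metric.

(** * The fundamental tensor of the modified metric: formula and positivity *)

Section Kropina.
Context {R : realType} {n : nat} {M : manifold R n}.
Variables (A : set (TM M)) (F0 F : TM M -> R) (b : one_form M) (q : R).
Hypothesis oA : open A.
(** Smoothness is asked of the square of [F0], and [F] is given through its square, so that conic
    Finsler metrics and Riemannian norms are treated alike. *)
Hypothesis sF0 : smoothTM_on A (fun v => F0 v ^+ 2).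
Hypothesis F0_gt0 : forall v, A v -> 0 < F0 v.
Hypothesis F0Z : forall v (c : R), A v -> 0 < c -> F0 (scaleTM c v) = c * F0 v.
Hypothesis F0_convex : strongly_convex A F0.
Hypothesis b_neq0 : forall v, A v -> form_eval b v != 0.
Hypothesis q_gt0 : 0 < q.
Hypothesis FE : forall v, A v ->
  F v ^+ 2 = (F0 v ^+ 2) `^ (q + 1) * (form_eval b v ^+ 2) `^ (- q).

Variables (v : TM M) (w : tangent (base_pt v)).
Hypothesis Av : A v.

Let p (r : R) := F0 (TVec (vec v + r *: w)) ^+ 2.
Let near_A : \forall r \near (0 : R), A (TVec (vec v + r *: w)) := near_line w oA Av.

Section Derivatives.
Variables (dp : R -> R) (ddp : R).
Hypothesis Dp : \forall r \near (0 : R), is_derive (r : R) (1 : R) p (dp r).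
Hypothesis Ddp : is_derive (0 : R) 1 dp ddp.

Lemma fundamental_tensor_ddp : fundamental_tensor F0 v w w = ddp / 2.
Proof.
have pE : \forall r \near (0 : R), derive1 p r = dp r.
  by apply: filterS Dp => r D; rewrite derive1E; exact: (derive_val (is_derive := D)).
rewrite fundamental_tensor_diag derive1E (near_eq_derive _ pE).
by rewrite [X in _ * X](derive_val (is_derive := Ddp)) mulrC.
Qed.

(** By homogeneity [F0 (v + t v + s w) ^ 2] is [(1 + t) ^ 2 p (s / (1 + t))]; its derivative in [s]
    at 0 is [(1 + t) dp 0], affine in [t] with slope [dp 0]. *)
Lemma fundamental_tensor_radial : fundamental_tensor F0 v (vec v) w = dp 0 / 2.
Proof.
rewrite /fundamental_tensor.
have E : \forall t \near (0 : R), derive1 (fun s : R =>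
    F0 (TVec (vec v + t *: vec v + s *: w)) ^+ 2) 0 = dp 0 + t * dp 0.
  near=> t.
  have t1 : 0 < 1 + t.
    near: t; exists 1 => //= s; rewrite /ball_ /= sub0r normrN => /ltr_normlP [].
    by rewrite -subr_gt0 opprK.
  pose k : R := (1 + t)^-1.
  have D0 : is_derive (0 + 0 * k : R) 1 p (dp 0).
    by rewrite mul0r addr0; exact: nbhs_singleton Dp.
  have Dk : is_derive (0 : R) 1 (fun s => (1 + t) ^+ 2 * p (0 + s * k)) _ :=
    is_deriveZ ((1 + t) ^+ 2) (is_derive1_comp (g := fun s : R => 0 + s * k) D0
      (is_derive_affine 0 k 0)).
  have pk : \forall s \near (0 : R), (1 + t) ^+ 2 * p (0 + s * k) =
      F0 (TVec (vec v + t *: vec v + s *: w)) ^+ 2.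
    have ck : {for 0, continuous (fun s : R => 0 + s * k)}.
      have [/derivable1_diffP + _] := is_derive_affine 0 k 0.
      exact: differentiable_continuous.
    (* Homogeneity is assumed at points of [A] only; the line stays in [A] for [s] small. *)
    have : \forall s \near (0 : R), A (TVec (vec v + (0 + s * k) *: w)).
      apply: (ck [set x | A (TVec (vec v + x *: w))]).
      by rewrite /= mul0r addr0; exact: near_A.
    apply: filterS => s /F0Z /(_ t1) E.
    rewrite /p -exprMn -E /scaleTM /=; congr (F0 (TVec _) ^+ 2).
    rewrite add0r scalerDr scalerA scalerDl scale1r mulrCA /k divff ?mulr1//.
    by rewrite gt_eqF.
  rewrite derive1E -(near_eq_derive _ pk) [LHS](derive_val (is_derive := Dk)).
  by rewrite /GRing.scale /= /k; field; rewrite gt_eqF.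
have D := is_derive_affine (dp 0) (dp 0) 0.
rewrite derive1E (near_eq_derive _ E).
by rewrite [X in _ * X](derive_val (is_derive := D)) mulrC.
Unshelve. all: by end_near. Qed.

(** Stands in for the bilinear expansion of the tensor, [dp 0] being twice the mixed term: only the
    one-variable function [p] gets differentiated. *)
Lemma fundamental_tensor_sub (c : R) :
  fundamental_tensor F0 v (w - c *: vec v) (w - c *: vec v) =
  ddp / 2 - c * dp 0 + c ^+ 2 * F0 v ^+ 2.
Proof.
rewrite fundamental_tensor_diag.
have E : \forall r \near (0 : R),
    F0 (TVec (vec v + r *: (w - c *: vec v))) ^+ 2
    = (1 - r * c) ^+ 2 * p (r / (1 - r * c)).
  have Dl := is_derive_affine (1 : R) (- c) 0.
  have cl : {for 0, continuous (fun r : R => 1 + r * - c)}.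
    by have [/derivable1_diffP /differentiable_continuous] := Dl.
  have l0 : \forall r \near (0 : R), 0 < 1 + r * - c.
    by apply: (cl [set x | 0 < x]); rewrite /= mul0r addr0; exact: lt_nbhsr.
  have cs : {for 0, continuous (fun r : R => r / (1 + r * - c))}.
    apply: cvgM; first exact: cvg_id.
    by apply: cvgV; [rewrite mul0r addr0 oner_neq0|exact: cl].
  have nA : \forall r \near (0 : R), A (TVec (vec v + (r / (1 + r * - c)) *: w)).
    by apply: (cs [set x | A (TVec (vec v + x *: w))]); rewrite /= mul0r; exact: near_A.
  near=> r.
  have lr : 0 < 1 - r * c by rewrite -mulrN; near: r.
  have /F0Z /(_ lr) E : A (TVec (vec v + (r / (1 - r * c)) *: w)).
    by rewrite -mulrN; near: r.
  rewrite /p -exprMn -E /scaleTM /=; congr (F0 (TVec _) ^+ 2).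
  rewrite [RHS]scalerDr scalerA mulrCA divff ?gt_eqF// mulr1 scalerBr scalerA.
  by rewrite scalerBl scale1r [RHS]addrAC addrA.
rewrite (near_eq_derive2 E) (derive2_homothety _ Dp Ddp) /p scale0r addr0.
have -> : F0 (TVec (vec v)) = F0 v by case: (v).
by field.
Unshelve. all: by end_near. Qed.

Lemma fundamental_tensor_kropinaE : fundamental_tensor F v w w =
  2^-1 * ((F0 v ^+ 2) `^ (q + 1) * (form_eval b v ^+ 2) `^ (- q) *
    (((q + 1) * (dp 0 / F0 v ^+ 2)
       - q * (2 * (form_eval b (TVec w) / form_eval b v))) ^+ 2
     + (q + 1) * (ddp / F0 v ^+ 2 - (dp 0 / F0 v ^+ 2) ^+ 2)
     + q * (2 * (form_eval b (TVec w) / form_eval b v) ^+ 2))).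
Proof.
rewrite fundamental_tensor_diag; congr (_ * _).
have vE : TVec (vec v) = v by case: (v).
have p0 : p 0 = F0 v ^+ 2 by rewrite /p scale0r addr0 vE.
have p_gt0 : 0 < p 0 by rewrite p0 exprn_gt0 ?F0_gt0.
rewrite -p0 -(derive2_kropina _ _ p_gt0 (b_neq0 Av) Dp Ddp).
apply: near_eq_derive2; apply: filterS near_A => r /FE ->.
by rewrite form_evalD vE.
Qed.

End Derivatives.

Let derivatives : exists (dp : R -> R) (ddp : R),
  (\forall r \near (0 : R), is_derive (r : R) (1 : R) p (dp r)) /\
  is_derive (0 : R) 1 dp ddp := smoothTM_line w oA sF0 Av.

Lemma fundamental_tensor_kropina :
  `|form_eval b v / F0 v| `^ (2 * q) * fundamental_tensor F v w w =
    (q + 1) * angular_metric F0 v w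
    + q * (q + 1) * (fundamental_tensor F0 v (vec v) w / F0 v
                     - F0 v / form_eval b v * form_eval b (TVec w)) ^+ 2
    + ((q + 1) * (fundamental_tensor F0 v (vec v) w / F0 v)
       - q * (F0 v / form_eval b v) * form_eval b (TVec w)) ^+ 2.
Proof.
have [dp [ddp [Dp Ddp]]] := derivatives.
rewrite (fundamental_tensor_kropinaE Dp Ddp) /angular_metric.
rewrite (fundamental_tensor_ddp Dp Ddp) (fundamental_tensor_radial Dp).
have f0 := F0_gt0 Av; have b0 := b_neq0 Av.
have f2 : (F0 v ^+ 2) `^ q != 0 by rewrite gt_eqF// powR_gt0// exprn_gt0.
(* Written with powers of squares, this prefactor cancels the powers in
   [fundamental_tensor_kropinaE] up to one factor [F0 v ^+ 2], and the rest is a rational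
   identity. *)
have -> : `|form_eval b v / F0 v| `^ (2 * q) =
    (form_eval b v ^+ 2) `^ q / (F0 v ^+ 2) `^ q.
  apply/(canRL (mulfK f2)); rewrite powRrM powR_mulrn// real_normK ?num_real//.
  by rewrite -powRM ?sqr_ge0// expr_div_n divfK// expf_neq0// gt_eqF.
have b2 : (form_eval b v ^+ 2) `^ q != 0.
  by rewrite gt_eqF// powR_gt0// exprn_even_gt0.
rewrite powRN powRD; last by rewrite (gt_eqF (exprn_gt0 2 f0)) implybT.
rewrite powRr1 ?sqr_ge0//.
by field; rewrite b0 b2 f2 gt_eqF.
Qed.

Lemma kropina_convex : w != 0 -> 0 < fundamental_tensor F v w w.
Proof.
move=> w0; have f0 := F0_gt0 Av; have b0 := b_neq0 Av.
have [dp [ddp [Dp Ddp]]] := derivatives.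
have gE := fundamental_tensor_ddp Dp Ddp.
have GE := fundamental_tensor_radial Dp.
have b2 : 0 < `|form_eval b v / F0 v| `^ (2 * q).
  by rewrite powR_gt0// normr_gt0 mulf_neq0// invr_neq0// gt_eqF.
rewrite -(pmulr_rgt0 _ b2) fundamental_tensor_kropina.
set G := fundamental_tensor F0 v (vec v) w in GE *.
pose c := G / F0 v ^+ 2.
have hE : angular_metric F0 v w =
    fundamental_tensor F0 v (w - c *: vec v) (w - c *: vec v).
  rewrite (fundamental_tensor_sub Dp Ddp) /angular_metric gE -/G /c.
  have -> : dp 0 = 2 * G by rewrite GE; field.
  by field; rewrite gt_eqF.
have q1 : 0 < q + 1 by rewrite addr_gt0.
(* Off the radial direction the angular term is positive and the two squares are nonnegative.
   Otherwise the angular term vanishes and the last square must be positive. *)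
have [wcv|wcv] := eqVneq (w - c *: vec v) 0; last first.
  have h_gt0 : 0 < angular_metric F0 v w.
    by rewrite hE; apply: F0_convex => //; exact: form_eval_neq0 b0.
  rewrite -addrA ltr_wpDr// ?mulr_gt0// addr_ge0// ?sqr_ge0//.
  by rewrite mulr_ge0 ?sqr_ge0// mulr_ge0 ?ltW.
have h0 : angular_metric F0 v w = 0.
  rewrite hE wcv fundamental_tensor_diag.
  rewrite (_ : (fun _ => _) = cst (F0 v ^+ 2)); last first.
    by apply/funext => r; rewrite scaler0 addr0; case: (v).
  have -> : derive1 (cst (F0 v ^+ 2) : R -> R) = cst 0.
    by apply/funext => r; rewrite derive1_cst.
  by rewrite derive1_cst mulr0.
have wE : w = c *: vec v by apply/eqP; rewrite -subr_eq0 wcv.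
have c0 : c != 0 by apply: contra_neq w0 => c0; rewrite wE c0 scale0r.
have bw : form_eval b (TVec w) = c * form_eval b v.
  by rewrite wE -form_evalZ.
rewrite h0 mulr0 add0r ltr_wpDl//.
  by rewrite mulr_ge0 ?sqr_ge0// mulr_ge0 ?ltW.
(* For [w = c v] the last square has base [(q + 1) c F0 v - q c F0 v]. *)
rewrite bw (_ : _ - _ = c * F0 v).
  by rewrite exprn_even_gt0//= mulf_neq0// gt_eqF.
have -> : G = c * F0 v ^+ 2 by rewrite /c divfK// expf_neq0// gt_eqF.
by field; rewrite b0 gt_eqF.
Qed.

End Kropina.

(** * Real powers of absolute values, and smoothness of powers and products on [TM] *)

Section Powers.
Context {R : realType}.
Implicit Types x y a q : R.

Lemma sqr_kropina x y a q : 0 <= x ->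
  (x `^ a / `|y| `^ q) ^+ 2 = (x ^+ 2) `^ a * (y ^+ 2) `^ (- q).
Proof.
move=> x0; rewrite expr_div_n powRN -(real_normK (num_real y)).
by rewrite ![(_ ^+ 2) `^ _]powRM// !expr2 !powRM.
Qed.

(** Shows smoothness away from [y = 0]: the right-hand side is a real power of the positive number
    [y ^+ 2]. *)
Lemma inv_norm_powR y q : (`|y| `^ q)^-1 = (y ^+ 2) `^ (- (q / 2)).
Proof.
rewrite powRN -(real_normK (num_real y)) -powR_mulrn// -powRrM.
by rewrite mulrCA mulfV ?mulr1.
Qed.

End Powers.

Section Smooth.
Context {R : realType} {n : nat} {M : manifold R n}.
Implicit Types (A : set (TM M)) (F : TM M -> R).

Lemma smoothTM_eq A F F' : open A -> (forall v, A v -> F v = F' v) ->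
  smoothTM_on A F -> smoothTM_on A F'.
Proof.
rewrite open_TME => oA FF' sF i k; apply: Ck_on_eq (sF i k); first exact: oA.
by move=> z [_ Az]; exact: FF'.
Qed.

Lemma smoothTM_M A F F' : open A ->
  smoothTM_on A F -> smoothTM_on A F' -> smoothTM_on A (fun v => F v * F' v).
Proof.
rewrite open_TME => oA sF sF' i k.
by have := Ck_onM (oA i) (sF i k) (sF' i k).
Qed.

Lemma smoothTM_powR A F (a : R) : open A -> (forall v, A v -> 0 < F v) ->
  smoothTM_on A F -> smoothTM_on A (fun v => F v `^ a).
Proof.
rewrite open_TME => oA F0 sF i k.
have F0' z : tcoords i A z -> 0 < (F \o tparam i) z by case=> _; exact: F0.
by have := Ck_on_powR a (oA i) F0' (sF i k).
Qed.

Lemma smoothTM_inv_norm_form A (b : one_form M) (q : R) : open A ->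
  (forall v, A v -> form_eval b v != 0) ->
  smoothTM_on A (fun v => (`|form_eval b v| `^ q)^-1).
Proof.
move=> oA b0; have sb := smoothTM_sub (@subsetT _ A) (smooth_form b).
have b2_gt0 v : A v -> 0 < form_eval b v * form_eval b v.
  by move=> Av; rewrite -expr2 exprn_even_gt0//= b0.
have := smoothTM_powR (F := fun v => form_eval b v * form_eval b v) (- (q / 2))
  oA b2_gt0 (smoothTM_M oA sb sb).
by apply: smoothTM_eq => // v _; rewrite inv_norm_powR expr2.
Qed.

End Smooth.

(** * Verification of the conic Finsler axioms, then specialization to Kropina metrics *)

Theorem corollary4p12 (R : realType) (n : nat) (M : manifold R n) :
  (forall (A0 : set (TM M)) (F0 : TM M -> R) (beta : one_form M) (q : R),
    conic_finsler A0 F0 -> 0 < q ->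
    let b := form_eval beta in
    let A := [set v | A0 v /\ b v != 0] in
    let F := fun v => F0 v `^ (q + 1) / `|b v| `^ q in
    base_pt @` A = setT ->
    conic_finsler A F /\
    forall (v : TM M) (w : tangent (base_pt v)), A v ->
      `|b v / F0 v| `^ (2 * q) * fundamental_tensor F v w w =
        (q + 1) * angular_metric F0 v w
        + q * (q + 1) * (fundamental_tensor F0 v (vec v) w / F0 v
                         - F0 v / b v * b (TVec w)) ^+ 2
        + ((q + 1) * (fundamental_tensor F0 v (vec v) w / F0 v)
           - q * (F0 v / b v) * b (TVec w)) ^+ 2) /\
  (forall (a : riemannian_metric M) (beta : one_form M),
    let alpha := metric_norm a in
    let b := form_eval beta in
    let A := [set v | b v != 0] in
    let F := fun v => alpha v ^+ 2 / `|b v| in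
    smoothTM_on A F /\ strongly_convex A F).
Proof.
split=> [A0 F0 beta q cF0 q0 b A F Asurj|a beta alpha b A F].
  have oA : open A by exact: open_form_neq0 (finsler_dom_open cF0).
  have bN0 v : A v -> b v != 0 by case.
  (* As [A] misses the zero section, [F0] is smooth and positive on all of [A], and in the axiom on
     zeros of [F] both sides are false. *)
  have vN0 v : A v -> vec v != 0 by move=> /bN0; exact: form_eval_neq0.
  have F0_gt0 v : A v -> 0 < F0 v.
    move=> Av; rewrite lt_neqAle (finsler_ge0 cF0 (proj1 Av)) andbT eq_sym.
    by apply/eqP => /(finsler_eq0 cF0 (proj1 Av)); apply/eqP/vN0.
  have F_gt0 v : A v -> 0 < F v.
    by move=> Av; rewrite divr_gt0// powR_gt0 ?normr_gt0 ?bN0 ?F0_gt0.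
  have sF0 : smoothTM_on A F0.
    apply: smoothTM_sub (finsler_smooth cF0) => v Av.
    by split; [exact: proj1 Av|exact/eqP/vN0].
  have sF : smoothTM_on A F.
    exact: smoothTM_M oA (smoothTM_powR _ oA F0_gt0 sF0)
      (smoothTM_inv_norm_form q oA bN0).
  have F0Z v c : A v -> 0 < c -> F0 (scaleTM c v) = c * F0 v.
    by move=> [+ _]; exact: finsler_homog.
  have cF0A : strongly_convex A F0.
    by move=> v [A0v _]; exact: (finsler_convex cF0).
  have FE v : A v -> F v ^+ 2 = (F0 v ^+ 2) `^ (q + 1) * (b v ^+ 2) `^ (- q).
    by move=> Av; rewrite sqr_kropina// ltW ?F0_gt0.
  have sF02 : smoothTM_on A (fun v => F0 v ^+ 2) by exact: smoothTM_M.
  split; last first.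
    by move=> v w Av; exact: fundamental_tensor_kropina.
  split=> //.
  - move=> v c [A0v bv] c0; split; first exact: (finsler_dom_conic cF0).
    by rewrite /b form_evalZ mulf_neq0// gt_eqF.
  - exact: smoothTM_continuous.
  - by apply: smoothTM_sub sF => v [].
  - by move=> v /F_gt0 /ltW.
  - move=> v Av; split=> [Fv|/eqP]; last by rewrite (negPf (vN0 _ Av)).
    by have := F_gt0 _ Av; rewrite Fv ltxx.
  - move=> v c Av c0; rewrite /F F0Z// /b form_evalZ normrM gtr0_norm//.
    rewrite !powRM ?(ltW c0) ?(ltW (F0_gt0 _ Av))// powRD; last first.
      by rewrite (gt_eqF c0) implybT.
    rewrite powRr1 ?(ltW c0)//.
    have cq : c `^ q != 0 by rewrite gt_eqF// powR_gt0.
    have bq : `|form_eval beta v| `^ q != 0.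
      by rewrite gt_eqF// powR_gt0// normr_gt0 bN0.
    by field; rewrite cq bq.
  - by move=> v Av _ w w0; exact: (kropina_convex oA sF02 F0_gt0 F0Z cF0A bN0 q0 FE).
have oA : open A.
  have := open_form_neq0 (b := beta) (@openT (TM M)).
  by rewrite (_ : [set v | setT v /\ _] = A)//; apply/seteqP; split=> v //= [].
have alpha_gt0 v : A v -> 0 < alpha v.
  by move=> Av; apply: metric_norm_gt0; exact: (form_eval_neq0 (b := beta)).
have salpha := smoothTM_sub (@subsetT _ A) (smooth_sqr_metric_norm a).
(* The Kropina metric is the case [q = 1] with [alpha] as [F0]; natural exponents become real ones
   to fit the general lemma. *)
have FE v : F v = alpha v `^ (1 + 1) / `|b v| `^ 1.
  by rewrite powRr1// (powR_mulrn 2) ?sqrtr_ge0.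
split.
  have := smoothTM_M oA salpha (smoothTM_inv_norm_form 1 oA (fun v Av => Av)).
  by apply: smoothTM_eq => // v _; rewrite powRr1.
move=> v Av _ w w0.
apply: (kropina_convex (b := beta) oA salpha alpha_gt0 _ _ (fun u Au => Au) ltr01
  _ Av w0).
- by move=> u c _; exact: metric_normZ.
- exact: strongly_convex_metric_norm.
- by move=> u _; rewrite FE sqr_kropina// sqrtr_ge0.
Qed.
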